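(* Let $S$ be a local semidomain. Then any invertible ideal of $S$ is principal.
   Context: A semiring is a set $S$ with operations $+,\cdot$ such that $(S,+)$ is a commutative monoid with identity $0$, $(S,\cdot)$ is a commutative monoid with identity $1\neq 0$, multiplication distributes over addition, and $s\cdot 0=0$ for all $s\in S$. An ideal of $S$ is a nonempty subset $I\subseteq S$ such that $a,b\in I$ and $s\in S$ imply $a+b, sa\in I$. A semiring is local if it has only one maximal ideal (an ideal maximal among the ideals $\neq S$). An element $s\in S$ is multiplicatively cancellable (MC) if $sb=sc$ implies $b=c$ for all $b,c\in S$; $S$ is a semidomain if every nonzero element of $S$ is MC. The total quotient semiring $Q(S)$ is the localization of $S$ at the set $M$ of its MC elements: the set of classes $a/b$ of pairs $(a,b)\in S\times M$ under $(a,b)\sim(c,d)$ iff $tad=tbc$ for some $t\in M$, with $a/b+c/d=(ad+bc)/(bd)$ and $(a/b)(c/d)=(ac)/(bd)$; $S$ is viewed inside $Q(S)$ via $s\mapsto s/1$. A fractional ideal of $S$ is a nonempty subset $I\subseteq Q(S)$ closed under addition and under multiplication by elements of $S$, such that $dI\subseteq S$ for some MC element $d\in S$. The product of fractional ideals is $IJ=\{a_1b_1+\cdots+a_nb_n: a_i\in I,\ b_i\in J\}$. A fractional ideal (in particular an ideal) $I$ of $S$ is invertible if $IJ=S$ for some fractional ideal $J$ of $S$. *)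

(* Defs.v *)
From HB Require Import structures.
From mathcomp Require Import all_boot all_algebra ring.
From mathcomp Require Import generic_quotient.
From mathcomp Require Import boolp classical_sets.

Set Implicit Arguments.
Unset Strict Implicit.
Unset Printing Implicit Defensive.

Import GRing.Theory.
Local Open Scope classical_set_scope.
Local Open Scope ring_scope.
Local Open Scope quotient_scope.

Section Ideals.
Variable S : comNzSemiRingType.

(* [GRing.lreg s] says that [s * _] is injective. *)
Definition semidomain := forall s : S, s != 0 -> GRing.lreg s.

Definition ideal (I : set S) :=
  [/\ I !=set0,
      forall a b, I a -> I b -> I (a + b)
    & forall s a, I a -> I (s * a)].

Definition maximal_ideal (M : set S) :=
  [/\ ideal M, M <> setT
    & forall J, ideal J -> J <> setT -> M `<=` J -> J = M].

Definition local_semiring := exists! M : set S, maximal_ideal M.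

Definition principal_ideal (I : set S) := exists a, I = range (fun s => s * a).

End Ideals.

Arguments semidomain S : clear implicits.
Arguments local_semiring S : clear implicits.

(* The localization at the multiplicatively cancellable elements: as [S] has no
   subtraction and may have zero divisors, neither [fraction] nor a ring
   localization applies. *)
Section TotalQuotient.
Variable S : comNzSemiRingType.

Record mcfrac := MCFrac { numden :> S * S; _ : `[< GRing.lreg numden.2 >] }.
HB.instance Definition _ := [isSub for numden].
HB.instance Definition _ := [Choice of mcfrac by <:].

Implicit Types x y z : mcfrac.

Lemma den_lreg x : GRing.lreg x.2.
Proof. by case: x => p /= /asboolP. Qed.
Arguments den_lreg : clear implicits.

Definition mkfrac (a b : S) (hb : GRing.lreg b) : mcfrac :=
  @MCFrac (a, b) (asboolT hb).

Definition equivmc x y : bool :=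
  `[< exists2 t : S, GRing.lreg t & t * x.1 * y.2 = t * x.2 * y.1 >].

Lemma equivmc_refl : reflexive equivmc.
Proof. by move=> x; apply/asboolP; exists 1; [exact: GRing.lreg1 | ring]. Qed.

Lemma equivmc_sym : symmetric equivmc.
Proof.
by move=> x y; apply/asboolP/asboolP => -[t tr e]; exists t => //; ring: e.
Qed.

Lemma equivmc_trans : transitive equivmc.
Proof.
move=> y x z /asboolP[t tr e] /asboolP[u ur f]; apply/asboolP.
exists (t * u * y.2); first by do 2?apply: GRing.lregM => //; exact: den_lreg.
transitivity (u * z.2 * (t * x.1 * y.2)); first by ring.
rewrite e; transitivity (t * x.2 * (u * y.1 * z.2)); first by ring.
by rewrite f; ring.
Qed.

Canonical equivmc_equiv := EquivRel equivmc equivmc_refl equivmc_sym equivmc_trans.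

Definition total_quot := {eq_quot equivmc}.
HB.instance Definition _ : EqQuotient _ equivmc total_quot :=
  EqQuotient.on total_quot.
HB.instance Definition _ := Choice.on total_quot.

Lemma equivmc_repr x : equivmc (repr (\pi_total_quot x)) x.
Proof. by rewrite -eqmodE reprK. Qed.

Definition tq_embed (s : S) : total_quot :=
  \pi_total_quot (mkfrac s (@GRing.lreg1 S)).

Definition addmc x y : mcfrac :=
  mkfrac (x.1 * y.2 + x.2 * y.1) (GRing.lregM (den_lreg x) (den_lreg y)).
Definition tq_add := lift_op2 total_quot addmc.

Lemma pi_tq_add : {morph \pi : x y / addmc x y >-> tq_add x y}.
Proof.
move=> x y; unlock tq_add; apply/eqmodP => /=; rewrite equivmc_sym.
have /asboolP[t tr e] := equivmc_repr x.
have /asboolP[u ur f] := equivmc_repr y.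
apply/asboolP; exists (t * u); first exact: GRing.lregM.
move: (repr _) (repr _) e f => y' x' e f /=.
transitivity (t * x'.1 * x.2 * u * y.2 * y'.2
            + u * y'.1 * y.2 * t * x.2 * x'.2); first by ring.
by rewrite e f; ring.
Qed.
Canonical pi_tq_add_morph := PiMorph2 pi_tq_add.

Definition mulmc x y : mcfrac :=
  mkfrac (x.1 * y.1) (GRing.lregM (den_lreg x) (den_lreg y)).
Definition tq_mul := lift_op2 total_quot mulmc.

Lemma pi_tq_mul : {morph \pi : x y / mulmc x y >-> tq_mul x y}.
Proof.
move=> x y; unlock tq_mul; apply/eqmodP => /=; rewrite equivmc_sym.
have /asboolP[t tr e] := equivmc_repr x.
have /asboolP[u ur f] := equivmc_repr y.
apply/asboolP; exists (t * u); first exact: GRing.lregM.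
move: (repr _) (repr _) e f => y' x' e f /=.
transitivity (t * x'.1 * x.2 * (u * y'.1 * y.2)); first by ring.
by rewrite e f; ring.
Qed.
Canonical pi_tq_mul_morph := PiMorph2 pi_tq_mul.

Lemma eq_frac x y : x.1 * y.2 = x.2 * y.1 -> \pi_total_quot x = \pi y.
Proof.
move=> e; apply/eqmodP/asboolP; exists 1; first exact: GRing.lreg1.
by rewrite !mul1r.
Qed.

Lemma tq_addA : associative tq_add.
Proof.
elim/quotW=> x; elim/quotW=> y; elim/quotW=> z; rewrite !piE.
by apply: eq_frac => /=; ring.
Qed.

Lemma tq_addC : commutative tq_add.
Proof.
by elim/quotW=> x; elim/quotW=> y; rewrite !piE; apply: eq_frac => /=; ring.
Qed.

Lemma tq_add0 : left_id (tq_embed 0) tq_add.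
Proof.
elim/quotW=> x; rewrite /tq_embed -pi_tq_add.
by apply: eq_frac => /=; ring.
Qed.

HB.instance Definition _ :=
  GRing.isNmodule.Build total_quot tq_addA tq_addC tq_add0.

Lemma tq_mulA : associative tq_mul.
Proof.
elim/quotW=> x; elim/quotW=> y; elim/quotW=> z; rewrite !piE.
by apply: eq_frac => /=; ring.
Qed.

Lemma tq_mulC : commutative tq_mul.
Proof.
by elim/quotW=> x; elim/quotW=> y; rewrite !piE; apply: eq_frac => /=; ring.
Qed.

Lemma tq_mul1 : left_id (tq_embed 1) tq_mul.
Proof.
elim/quotW=> x; rewrite /tq_embed -pi_tq_mul.
by apply: eq_frac => /=; ring.
Qed.

Lemma tq_mulDl : left_distributive tq_mul tq_add.
Proof.
elim/quotW=> x; elim/quotW=> y; elim/quotW=> z; rewrite !piE.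
by apply: eq_frac => /=; ring.
Qed.

Lemma tq_mul0 : left_zero (tq_embed 0) tq_mul.
Proof.
elim/quotW=> x; rewrite /tq_embed -pi_tq_mul.
by apply: eq_frac => /=; ring.
Qed.

Lemma tq_1neq0 : tq_embed 1 != tq_embed 0.
Proof.
apply/eqP => /eqmodP /asboolP[t tr] /=; rewrite !mulr1 mulr0.
by rewrite -[t in t = _]mulr1 -[0](mulr0 t) => /tr /eqP; rewrite oner_eq0.
Qed.

HB.instance Definition _ := GRing.Nmodule_isComNzSemiRing.Build total_quot
  tq_mulA tq_mulC tq_mul1 tq_mulDl tq_mul0 tq_1neq0.

Fact tq_embed_nmod : nmod_morphism tq_embed.
Proof.
split=> [//|s t]; rewrite /tq_embed -[RHS]pi_tq_add.
by apply: eq_frac => /=; ring.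
Qed.
HB.instance Definition _ :=
  GRing.isNmodMorphism.Build S total_quot tq_embed tq_embed_nmod.

Fact tq_embed_monoid : monoid_morphism tq_embed.
Proof.
split=> [//|s t]; rewrite /tq_embed -[RHS]pi_tq_mul.
by apply: eq_frac => /=; ring.
Qed.
HB.instance Definition _ :=
  GRing.isMonoidMorphism.Build S total_quot tq_embed tq_embed_monoid.

Lemma tq_embed_inj : injective tq_embed.
Proof.
by move=> a b /eqmodP /asboolP[t tr] /=; rewrite !mulr1 => /tr.
Qed.

Definition fractional_ideal (I : set total_quot) :=
  [/\ I !=set0,
      forall p q, I p -> I q -> I (p + q),
      forall (s : S) q, I q -> I (tq_embed s * q)
    & exists2 d : S, GRing.lreg d &
        forall q, I q -> range tq_embed (tq_embed d * q)].

Definition fractional_mul (I J : set total_quot) : set total_quot :=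
  [set q | exists n (a b : 'I_n.+1 -> total_quot),
    [/\ forall i, I (a i), forall i, J (b i) & q = \sum_i a i * b i]].

Definition invertible (I : set total_quot) :=
  exists2 J, fractional_ideal J & fractional_mul I J = range tq_embed.

Definition invertible_ideal (I : set S) := invertible (tq_embed @` I).

Lemma ideal_fractional (I : set S) :
  ideal I -> fractional_ideal (tq_embed @` I).
Proof.
move=> [[a Ia] ID IM]; split.
- by exists (tq_embed a), a.
- by move=> _ _ [u Iu <-] [v Iv <-]; exists (u + v); rewrite ?rmorphD //; exact: ID.
- by move=> s _ [u Iu <-]; exists (s * u); rewrite ?rmorphM //; exact: IM.
- exists 1; first exact: GRing.lreg1.
  by move=> _ [u Iu <-]; exists u => //; rewrite rmorph1 mul1r.
Qed.

End TotalQuotient.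

(* Main.v *)
Require Import Defs.
From mathcomp Require Import all_boot all_algebra ring.
From mathcomp Require Import boolp classical_sets.

Import GRing.Theory.
Local Open Scope classical_set_scope.
Local Open Scope ring_scope.

(** The argument is the classical one for rings, and it survives without
    subtraction.  Write [I J = S] with [J] fractional.  Then [1] is a finite sum
    of products [a_i b_i] with [a_i] in [I] and [b_i] in [J], each of which lies
    in [S].  They cannot all lie in the maximal ideal [M], so some [u = a_i b_i]
    is outside [M].  In a local semiring such a [u] is a unit
    ([local_notin_maximal_unit]): otherwise the ideal [u S] would be proper,
    hence contained in a maximal ideal ([exists_maximal_ideal]), that is, in [M].
    Finally [a_i] generates [I], because [x = u^-1 (x b_i) a_i] for every [x] in
    [I], where [x b_i] belongs to [I J = S]. *)

Section Ideals.
Set Implicit Arguments.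
Unset Strict Implicit.
Variable S : comNzSemiRingType.
Implicit Types (I J : set S) (a b s u x : S).

Lemma ideal0 I : ideal I -> I 0.
Proof. by move=> [[a Ia] _ IM]; rewrite -(mul0r a); exact: IM. Qed.

Lemma ideal_sum I (T : Type) (r : seq T) (F : T -> S) :
  ideal I -> (forall i, I (F i)) -> I (\sum_(i <- r) F i).
Proof.
by move=> Iid IF; have [_ ID _] := Iid; elim/big_ind: _ => //; exact: ideal0.
Qed.

Lemma ideal_properE I : ideal I -> I <> setT <-> ~ I 1.
Proof.
move=> [_ _ IM]; split=> [IT I1|I1 IT]; last by apply: I1; rewrite IT.
by apply: IT; apply/seteqP; split=> // s _; rewrite -(mulr1 s); exact: IM.
Qed.

Lemma ideal_range_mul a : ideal (range (fun s => s * a)).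
Proof.
split; first by exists (1 * a), 1.
- by move=> _ _ [s _ <-] [t _ <-]; exists (s + t); rewrite ?mulrDl.
- by move=> s _ [t _ <-]; exists (s * t); rewrite ?mulrA.
Qed.

(** Zorn's lemma.  It is applied to the sets [X] such that [I `|` X] is a proper
    ideal rather than to the proper ideals containing [I], so that the union of
    the empty chain, which is empty, also qualifies. *)
Lemma exists_maximal_ideal I :
  ideal I -> I <> setT -> exists2 M, maximal_ideal M & I `<=` M.
Proof.
move=> Iid /(ideal_properE Iid) I1; have [[a0 Ia0] ID IM] := Iid.
pose P X := ideal (I `|` X) /\ ~ (I `|` X) 1.
have [|X [[IXid IX1] Xmax]] := @Zorn_bigcup _ P.
  move=> F FP Ftot; split; last first.
    by move=> [//|[X FX X1]]; apply: (FP _ FX).2; right.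
  have sub X : F X -> I `|` X `<=` I `|` \bigcup_(Y in F) Y.
    by move=> FX x [Ix|Xx]; [left|right; exists X].
  split; first by exists a0; left.
  - have add X a b : F X -> (I `|` X) a -> (I `|` X) b ->
        (I `|` \bigcup_(Y in F) Y) (a + b).
      by move=> FX Ia Ib; apply: (sub X FX); have [[_ + _] _] := FP _ FX; exact.
    move=> a b [Ia|[X FX Xa]] [Ib|[Y FY Yb]].
    + by left; exact: ID.
    + by apply: (add Y) => //; [left|right].
    + by apply: (add X) => //; [right|left].
    + by have [XY|YX] := Ftot X Y FX FY;
        [apply: (add Y)|apply: (add X)] => //; right; auto.
  - move=> s a [Ia|[X FX Xa]]; first by left; exact: IM.
    by apply: (sub X FX); have [[_ _ +] _] := FP _ FX; apply; right.
exists (I `|` X); last exact: subsetUl.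
split=> //; first exact/ideal_properE.
move=> J Jid /(ideal_properE Jid) J1 IXJ.
apply/seteqP; split=> // x Jx; apply: contrapT => nIXx.
have IJ : I `|` J = J by apply/setUidPr => y Iy; apply: IXJ; left.
apply: (Xmax J); last by rewrite /P IJ.
by split=> [y Xy|JX]; [apply: IXJ; right|apply: nIXx; right; exact: JX].
Qed.

(** If [u] is not a unit, the ideal [u S] is proper, so some maximal ideal
    contains it; by uniqueness that ideal is [M]. *)
Lemma local_notin_maximal_unit M u :
  local_semiring S -> maximal_ideal M -> ~ M u -> exists v, v * u = 1.
Proof.
move=> [M0 [_ M0uniq]] Mmax nMu; apply: contrapT => nu.
have uid := ideal_range_mul u.
have [|N Nmax uN] := exists_maximal_ideal uid.
  by apply/(ideal_properE uid) => -[v _ vu]; apply: nu; exists v.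
apply: nMu; rewrite -(M0uniq _ Mmax) (M0uniq _ Nmax).
by apply: uN; exists 1; rewrite ?mul1r.
Qed.

End Ideals.

Section TotalQuotient.
Set Implicit Arguments.
Unset Strict Implicit.
Variable S : comNzSemiRingType.

Lemma fractional_mul_mem (I J : set (total_quot S)) p q :
  I p -> J q -> fractional_mul I J (p * q).
Proof.
move=> Ip Jq; exists 0, (fun=> p), (fun=> q).
by rewrite big_ord1.
Qed.

(** Multiplication by [q] sends [I] into [I J = S], and [v] makes it a
    one-sided inverse of multiplication by [a]: since [v (a q) = 1], every [x] in
    [I] equals [v (x q) a], a multiple of [a] with coefficient in [S]. *)
Lemma principal_ideal_unit_mul (I : set S) (J : set (total_quot S)) a q u v :
  ideal I -> fractional_mul (@tq_embed S @` I) J = range (@tq_embed S) ->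
  I a -> J q -> tq_embed u = tq_embed a * q -> v * u = 1 -> principal_ideal I.
Proof.
move=> [_ _ IM] IJ Ia Jq uE vu; exists a; apply/seteqP; split; last first.
  by move=> _ [s _ <-]; exact: IM.
move=> x Ix.
have : fractional_mul (@tq_embed S @` I) J (tq_embed x * q).
  by apply: fractional_mul_mem => //; exists x.
rewrite IJ => -[y _ yE]; exists (v * y) => //.
apply: tq_embed_inj; rewrite !rmorphM /= yE.
rewrite -[RHS]mul1r -(rmorph1 (@tq_embed S)) -vu rmorphM /= uE.
by ring.
Qed.

End TotalQuotient.

Theorem proposition2p5 (S : comNzSemiRingType) (Sdom : semidomain S)
    (Sloc : local_semiring S) (I : set S) (Iid : ideal I) (Iinv : invertible_ideal I) :
  principal_ideal I.
Proof.
have [J _ IJ] := Iinv; have [M [Mmax _]] := Sloc.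
have [Mid /(ideal_properE Mid) M1 _] := Mmax.
have : range (@tq_embed S) 1 by exists 1; rewrite ?rmorph1.
rewrite -{1}IJ => -[n [p [q [Ip Jq sumE]]]].
have /choice[u uE] i : exists u, tq_embed u = p i * q i.
  have : fractional_mul (@tq_embed S @` I) J (p i * q i).
    exact: fractional_mul_mem.
  by rewrite IJ => -[u _ uE]; exists u.
have [i nMu] : exists i, ~ M (u i).
  apply: contrapT => /forallNP Mu; apply: M1.
  suff -> : 1 = \sum_i u i by apply: ideal_sum => // i; exact: contrapT.
  apply: tq_embed_inj; rewrite rmorph1 rmorph_sum sumE.
  by apply: eq_bigr => i _; exact: (esym (uE i)).
have [v vu] := local_notin_maximal_unit Sloc Mmax nMu.
have [a Ia aE] := Ip i.
apply: (principal_ideal_unit_mul Iid IJ Ia (Jq i) _ vu).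
by rewrite uE aE.
Qed.
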